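(* Let $S=k[x_1,\ldots,x_n]$ be a polynomial ring over a field $k$ and let $I\subset S$ be a squarefree monomial ideal which is generated in one degree. If the first syzygy graph $G_I$ is a tree, then the following conditions are equivalent: (a) $I$ has a linear resolution; (b) $I$ has linear relations; (c) $G_I^{(u,v)}$ is a connected graph for all $u,v\in G(I)$; (d) for all $u,v\in G(I)$, if $u=u_1,u_2,\ldots,u_s=v$ is the unique path between $u$ and $v$ in $G_I$, then $F(u_j)\subseteq F(u_i)\cup F(u_k)$ for all $1\le i\le j\le k\le s$; (e) $L$ has a linear resolution for every monomial ideal $L\subseteq I$ such that $G(L)\subseteq G(I)$ and $G_L$ is a line.
   Context: $G(I)=\{u_1,\ldots,u_m\}$ denotes the minimal monomial generating set of $I$, generated in degree $d$; $F(u)=\{i : x_i\mid u\}$. Let $\varphi:\bigoplus_{i} S e_i\to I$, $e_i\mapsto u_i$. $I$ has linear relations if $\ker(\varphi)$ is minimally generated by linear forms (elements whose coefficients with respect to the $e_i$ are of degree 1). $I$ has a linear resolution if its minimal graded free resolution is $0\to S(-d-p)^{\beta_p}\to\cdots\to S(-d-1)^{\beta_1}\to S(-d)^{\beta_0}\to I\to 0$. First syzygy graph $G_I$: start with the graph on vertex set $G(I)$ in which distinct $u_i,u_j$ are adjacent iff there are variables $x,y$ with $xu_i=yu_j$; such an edge gives the linear relation $xe_i-ye_j\in\ker(\varphi)$. A triangle is of type (i) if its vertices have supports $A\cup\{j,k\}$, $A\cup\{i,k\}$, $A\cup\{i,j\}$ for some set $A$ and distinct $i,j,k\notin A$; then one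 of the three corresponding relations is a combination of the other two. $G_I$ is obtained by deleting redundant edges of triangles of type (i) (one edge from each such triangle) so that no such triangle remains and the relations of the remaining edges form a minimal generating set of the degree $d+1$ part of $\ker(\varphi)$; any fixed choice of such deletions is allowed. $G_L$ is formed in the same way for $L$. $G_I^{(u,v)}$ is the induced subgraph of $G_I$ on $\{w\in G(I): F(w)\subseteq F(u)\cup F(v)\}$. A line is a path graph. *)

(* Defs.v *)
From mathcomp Require Export all_boot all_order all_algebra.
From mathcomp Require Export finmap.
From mathcomp Require Export mpoly.

Set Implicit Arguments.
Unset Strict Implicit.
Unset Printing Implicit Defensive.

Import GRing.Theory.
Local Open Scope ring_scope.
Local Open Scope fset_scope.

(** Ideals of [{mpoly K[n]}] are Prop-valued predicates; monomials are
    exponent vectors [u : 'X_{1..n}], the polynomial being ['X_[u]]. *)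

Section Monomials.
Variable n : nat.
Implicit Types u v w : 'X_{1..n}.

(** [F(u)] *)
Definition mvars u : {set 'I_n} := [set i | (0 < u i)%N].

Definition squarefree_mon u : Prop := forall i, (u i <= 1)%N.

End Monomials.

Section MonomialIdeals.
Variables (K : fieldType) (n : nat).
Implicit Types (I : {mpoly K[n]} -> Prop) (G H : {fset 'X_{1..n}}).

Definition mon_ideal G (f : {mpoly K[n]}) : Prop :=
  exists c : 'X_{1..n} -> {mpoly K[n]}, f = \sum_(u <- G) c u * 'X_[u].

(** [I] is a monomial ideal and [G] is its minimal monomial generating set. *)
Definition is_min_mon_gens I G : Prop :=
  (forall f, I f <-> mon_ideal G f) /\
  (forall H, H `<` G -> ~ (forall f, I f <-> mon_ideal H f)).

End MonomialIdeals.

Section Syzygies.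
Variables (K : fieldType) (n : nat) (G : {fset 'X_{1..n}}).

(** The free module with basis [e_u], [u] in [G], and the map [e_u |-> u]. *)
Definition phi (v : {ffun G -> {mpoly K[n]}}) : {mpoly K[n]} :=
  \sum_(u : G) v u * 'X_[val u].

(** The part of degree [d + 1] of the kernel when [G] is of degree [d]
    (recall that [0 \is 1.-homog]). *)
Definition linear_syzygy (v : {ffun G -> {mpoly K[n]}}) : Prop :=
  phi v = 0 /\ forall u, v u \is 1.-homog.

Definition in_poly_span (q : nat) (r : 'I_q -> {ffun G -> {mpoly K[n]}})
    (J : {set 'I_q}) (v : {ffun G -> {mpoly K[n]}}) : Prop :=
  exists c : 'I_q -> {mpoly K[n]},
    forall u, v u = \sum_(j in J) c j * r j u.

Definition has_linear_relations : Prop :=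
  exists (q : nat) (r : 'I_q -> {ffun G -> {mpoly K[n]}}),
    [/\ forall j, linear_syzygy (r j),
        forall v, phi v = 0 <-> in_poly_span r [set: 'I_q] v
      & forall J : {set 'I_q}, J \proper [set: 'I_q] ->
          ~ (forall v, phi v = 0 <-> in_poly_span r J v)].

End Syzygies.

Section Resolutions.
Variables (K : fieldType) (n : nat).

(** A sequence [... -> F_1 -> F_0 -> S] of graded free modules
    [F_i = \bigoplus_j S(- shift i j)], with [j] ranging over ['I_(rank i)],
    whose elements are row vectors; matrices act on the right. *)
Record graded_free_seq := GradedFreeSeq {
  rank : nat -> nat;
  shift : forall i, 'I_(rank i) -> nat;
  diff : forall i, 'M[{mpoly K[n]}]_(rank i.+1, rank i);
  augm : 'cV[{mpoly K[n]}]_(rank 0)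
}.

(** [f] is a homogeneous map [S(-a) -> S(-b)] of degree 0. *)
Definition homog_entry (a b : nat) (f : {mpoly K[n]}) : bool :=
  if (b <= a)%N then f \is (a - b)%N.-homog else f == 0.

(** Minimality: the differentials have entries in the ideal of the variables,
    i.e. with zero constant coefficient. *)
Definition is_min_graded_free_res (I : {mpoly K[n]} -> Prop)
    (C : graded_free_seq) : Prop :=
  [/\ (forall j, homog_entry (shift j) 0 (augm C j ord0)) /\
      (forall i r c, homog_entry (shift r) (shift c) (diff C i r c)),
      forall i r c, (diff C i r c)@_(0%MM) = 0,
      (forall f, I f <->
         exists v : 'rV[{mpoly K[n]}]_(rank C 0), f = (v *m augm C) ord0 ord0),
      (forall v : 'rV[{mpoly K[n]}]_(rank C 0),
         v *m augm C = 0 <-> exists w, v = w *m diff C 0) /\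
      (forall i (v : 'rV[{mpoly K[n]}]_(rank C i.+1)),
         v *m diff C i = 0 <-> exists w, v = w *m diff C i.+1)
    & exists p, forall i, (p < i)%N -> rank C i = 0%N].

Definition has_linear_resolution (d : nat) (I : {mpoly K[n]} -> Prop) : Prop :=
  exists C, is_min_graded_free_res I C /\
    forall i (j : 'I_(rank C i)), shift j = (d + i)%N.

End Resolutions.

(** Simple graphs on a finite vertex set [V : {fset T}] are given by their edge
    set [E : {fset {fset T}}], whose members are pairs [[fset u; v]], [u != v]. *)
Section Graphs.
Variable T : choiceType.
Implicit Types (V : {fset T}) (E : {fset {fset T}}).

Definition adj E : rel T := fun u v => (u != v) && ([fset u; v] \in E).

Definition induced_edges E V : {fset {fset T}} := [fset e in E | e `<=` V].

Definition connected_graph V E : Prop :=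
  V != fset0 /\
  forall u v, u \in V -> v \in V ->
    exists p, path (adj E) u p /\ last u p = v.

Definition acyclic_graph E : Prop :=
  forall c : seq T, (2 < size c)%N -> uniq c -> ~~ cycle (adj E) c.

Definition is_tree V E : Prop := connected_graph V E /\ acyclic_graph E.

(** Path graphs, on at least one vertex. *)
Definition is_line V E : Prop :=
  exists s : seq T,
    [/\ s != [::], uniq s, V =i s
      & forall u v, u \in V -> v \in V ->
          adj E u v = (index v s == (index u s).+1) ||
                      (index u s == (index v s).+1)].

End Graphs.

Section FirstSyzygyGraph.
Variables (K : fieldType) (n : nat).
Implicit Types (G : {fset 'X_{1..n}}) (E : {fset {fset 'X_{1..n}}}).

Definition lin_adj (u v : 'X_{1..n}) : bool :=
  (u != v) && [exists x, exists y, (U_(x) + u == U_(y) + v)%MM].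

Definition lin_edges G : {fset {fset 'X_{1..n}}} :=
  [fset [fset u; v] | u in G, v in G & lin_adj u v].

Definition triangle_i E (a b c : 'X_{1..n}) : Prop :=
  [/\ adj E a b, adj E b c, adj E a c &
      exists (A : {set 'I_n}) (i j k : 'I_n),
        [/\ [/\ i != j, j != k & i != k],
            [/\ i \notin A, j \notin A & k \notin A]
          & [/\ mvars a = A :|: [set j; k], mvars b = A :|: [set i; k]
              & mvars c = A :|: [set i; j]]]].

(** The edge sets obtained by successive deletions of an edge of a triangle of
    type (i) of the current graph. *)
Inductive reduction G : {fset {fset 'X_{1..n}}} -> Prop :=
| reduction_start : reduction G (lin_edges G)
| reduction_step E a b c :
    reduction G E -> triangle_i E a b c -> reduction G (E `\ [fset a; b]).

(** The relations [x e_u - y e_v] attached to the edges of [E]. *)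
Definition edge_relation G E (r : {ffun G -> {mpoly K[n]}}) : Prop :=
  exists u v x y, [/\ adj E u v, (U_(x) + u = U_(y) + v)%MM &
    r = [ffun w : G => (val w == u)%:R * 'X_x - (val w == v)%:R * 'X_y]].

(** The linear syzygies are the [K]-span of the relations of the edges. *)
Definition edges_generate G E : Prop :=
  forall v : {ffun G -> {mpoly K[n]}},
    linear_syzygy v <->
    exists (q : nat) (c : 'I_q -> K) (r : 'I_q -> {ffun G -> {mpoly K[n]}}),
      (forall j, edge_relation E (r j)) /\ v = \sum_j c j *: r j.

(** Minimality is stated on edges, as an edge determines its relation only
    up to sign. *)
Definition is_first_syzygy_graph G E : Prop :=
  [/\ reduction G E,
      forall a b c, ~ triangle_i E a b c,
      edges_generate G E
    & forall E', E' `<` E -> ~ edges_generate G E'].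

End FirstSyzygyGraph.

(** Vertex set of [G_I^{(u,v)}]. *)
Definition between n (G : {fset 'X_{1..n}}) (u v : 'X_{1..n}) :
    {fset 'X_{1..n}} :=
  [fset w in G | mvars w \subset mvars u :|: mvars v].

(* Main.v *)
Require Import Defs.
From mathcomp Require Import zify.
From Stdlib Require Import Classical_Prop.

(** Let [x b = y w] be the linear relation of an edge between two squarefree
    monomials of degree [d]. Its multidegree is [lcm(b, w)], and the support of
    this lcm is called the type of the edge. The generators that divide a given
    monomial of degree [d + 1] are pairwise adjacent, so the graph of all linear
    adjacencies is a union of cliques, one for each type, and deleting edges of
    triangles of type (i) keeps every clique connected ([reduction_walk]). If
    what remains is a tree, the cliques can only hang together like the blocks
    of a tree: deleting the edges of one type leaves the members of its clique in
    different components.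

    The five conditions meet in the property [btw_connected], which does not
    depend on the choice of the deleted edges: any two generators [a], [b] are
    joined by a walk of linear adjacencies through divisors of [lcm(a, b)].

    It implies linear resolutions. Let [H] be a set of generators that is
    connected by linear adjacencies, listed so that every [b] in the list except
    the last is adjacent to some later [w], say [x b = y w]. If [x] did not
    divide a later [a], the walk from [a] to [b] through divisors of
    [lcm(a, b)], none of which is a multiple of [x], would avoid all edges of
    the type of [(b, w)]; but after deleting these, [b] is separated from every
    later [a] ([divides_of_btw_walk]). So the colon ideal of the later
    generators by [b] is [(x)]. The relations [x e_b - y e_w] then form a
    triangular system that is free and generates all syzygies, and the ideal
    has a linear resolution of length one ([linear_quotients_resolution]). This
    gives (a) for [H = G], and (e) for the vertex sets of lines.

    Conversely, a linear resolution has linear first syzygies, which a change of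
    basis moves to the generators [G] ([linear_resolution_relations]). If linear
    relations generate, the syzygy of two generators [u], [v] lies in the span
    of the edges, and its component of multidegree [lcm(u, v)] only involves
    edges between divisors of [lcm(u, v)], which therefore connect [u] to [v]
    ([linear_relations_connected]). In a tree the connecting walk covers the
    unique path, whence (d), and (d) for the two ends of a path is
    [btw_connected]. Under (e) the last two steps are applied to the vertex set
    of an induced path of linear adjacencies from [a] to [b]: it contains no
    triangle, so its first syzygy graph is a line whatever the choices
    ([lines_btw_connected]). *)

Set Implicit Arguments.
Unset Strict Implicit.
Unset Printing Implicit Defensive.

Import GRing.Theory.
Local Open Scope fset_scope.

(** * Walks and induced paths *)

Section Walks.
Variable T : eqType.
Implicit Types (e : rel T) (u v w : T) (p s : seq T).

Definition walk e u v := exists p, path e u p /\ last u p = v.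

Lemma walk_refl e u : walk e u u.
Proof. by exists [::]. Qed.

Lemma walk_edge e u v : e u v -> walk e u v.
Proof. by move=> euv; exists [:: v]; rewrite /= euv. Qed.

Lemma walk_trans e v u w : walk e u v -> walk e v w -> walk e u w.
Proof.
move=> [p [pp <-]] [q [pq <-]]; exists (p ++ q).
by rewrite cat_path pp pq last_cat.
Qed.

Lemma walk_bind e e' u v :
  (forall c d, e c d -> walk e' c d) -> walk e u v -> walk e' u v.
Proof.
move=> h [p [+ <-]]; elim: p u => [|c p IH] u /=; first by move=> _; apply: walk_refl.
by move=> /andP[/h euc /IH]; apply: walk_trans.
Qed.

Lemma walk_sub e e' u v : subrel e e' -> walk e u v -> walk e' u v.
Proof. by move=> h; apply: walk_bind => c d /h; apply: walk_edge. Qed.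

Lemma walk_sym e u v : ssrbool.symmetric e -> walk e u v -> walk e v u.
Proof.
move=> es [p [+ <-]]; elim: p u => [|c p IH] u /=; first by move=> _; apply: walk_refl.
by move=> /andP[euc /IH /walk_trans]; apply; apply: walk_edge; rewrite es.
Qed.

Lemma walk_closed e (P : T -> Prop) u v :
  (forall c d, e c d -> P c -> P d) -> walk e u v -> P u -> P v.
Proof.
move=> h [p [+ <-]]; elim: p u => [//|c p IH] u /= /andP[/h euc /IH].
by move=> hP /euc.
Qed.

Lemma walk_uniq e u v : walk e u v ->
  exists p, [/\ path e u p, last u p = v & uniq (u :: p)].
Proof. by move=> [p [+ <-]] => /shortenP[q pq uq _]; exists q. Qed.

Lemma path_all e (P : pred T) u p : path e u p -> all P (u :: p) ->
  path (fun c d => [&& e c d, P c & P d]) u p.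
Proof.
elim: p u => [//|c p IH] u /= /andP[-> pp] /and3P[-> Pc al] /=.
by rewrite Pc IH //= Pc.
Qed.

(** Chordless paths, in a recursive form that can be built up along an arbitrary
    walk, where a shortest walk would have to be found by a global search. *)
Fixpoint induced_path e s : bool :=
  if s is a :: s' then
    (if s' is z :: t then [&& e a z, a \notin s' & ~~ has (e a) t] else true)
    && induced_path e s'
  else true.

Lemma induced_path_drop e s1 s2 : induced_path e (s1 ++ s2) -> induced_path e s2.
Proof. by elim: s1 => [//|a s1 IH] /= /andP[_]. Qed.

Lemma has_last (P : pred T) s : has P s ->
  exists s1 z s2, [/\ s = s1 ++ z :: s2, P z & ~~ has P s2].
Proof.
elim: s => [//|a s IH] /=; case h: (has P s).
  by move=> _; have [s1 [z [s2 [-> Pz h2]]]] := IH h; exists (a :: s1), z, s2.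
by rewrite orbF => Pa; exists [::], a, s; rewrite h.
Qed.

(** Adding a vertex [u] in front of an induced path, a shortcut leads from [u] to
    its last neighbour on the path. *)
Lemma walk_induced e u v : walk e u v ->
  exists p, induced_path e (u :: p) /\ last u p = v.
Proof.
move=> [p [+ <-]]; elim: p u => [|c p IH] u; first by exists [::].
move=> /= /andP[euc /IH [q [iq <-]]] {p IH}.
have [uq|ucq] := boolP (u \in c :: q).
  have [p1 [p2 E]] : exists p1 p2, c :: q = p1 ++ u :: p2.
    by case/splitPr: uq => p1 p2; exists p1, p2.
  exists p2; split; first by move: iq; rewrite E; apply: induced_path_drop.
  by have := congr1 (last u) E; rewrite last_cat /=.
have /has_last [s1 [z [s2 [E ez h2]]]] : has (e u) (c :: q) by rewrite /= euc.
exists (z :: s2); split; last by have := congr1 (last u) E; rewrite last_cat.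
have /induced_path_drop : induced_path e (s1 ++ z :: s2) by rewrite -E.
move: ucq; rewrite E mem_cat negb_or => /andP[_ uz].
by move=> hz; apply/andP; split=> //; rewrite ez uz.
Qed.

Lemma induced_path_uniq e s : induced_path e s -> uniq s.
Proof.
elim: s => [//|a [//|z t] IH] /andP[/and3P[_ az _] /IH uz].
by rewrite cons_uniq az.
Qed.

Lemma induced_path_nth e s x0 i j : ssrbool.symmetric e -> irreflexive e ->
  induced_path e s -> (i < size s)%N -> (j < size s)%N ->
  e (nth x0 s i) (nth x0 s j) = (j == i.+1) || (i == j.+1).
Proof.
move=> es ei; elim: s i j => [//|a [|z t] IH] i j.
  by case: i j => [|i] [|j] //; rewrite ei.
move=> /andP[/and3P[az _ ht] hi].
have h0 k : (k < size (z :: t))%N -> e a (nth x0 (z :: t) k) = (k == 0%N).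
  case: k => [|k] /=; first by rewrite az.
  move=> lk; apply/negbTE; move: ht; rewrite -all_predC => /all_nthP.
  by apply.
case: i j => [|i] [|j] li lj.
- by rewrite ei.
- by rewrite [nth _ _ 0]/= [nth _ _ j.+1]/= h0 // orbF.
- by rewrite es [nth _ _ 0]/= [nth _ _ i.+1]/= h0.
- by rewrite ![nth x0 (a :: _) _]/= IH.
Qed.

(** Read backwards, such a sequence builds up a connected graph vertex by vertex,
    starting from its last entry. *)
Definition connected_order e s := forall x0 r, (r.+1 < size s)%N ->
  exists2 p, (r < p < size s)%N & e (nth x0 s r) (nth x0 s p).

(** Following the chosen neighbours, which come ever later in the sequence, every
    entry after the [r]-th one reaches the last entry without meeting the [r]-th. *)
Lemma connected_order_walk e s x0 r i j : ssrbool.symmetric e -> uniq s ->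
  connected_order e s -> (r < i < size s)%N -> (r < j < size s)%N ->
  walk (fun c d => [&& e c d, c != nth x0 s r & d != nth x0 s r])
    (nth x0 s i) (nth x0 s j).
Proof.
move=> es us hs; set e' := fun c d => _.
have es' : ssrbool.symmetric e' by move=> c d; rewrite /e' es; congr andb; rewrite andbC.
suff hw k l : (r < k < size s)%N -> (size s - k <= l)%N ->
    walk e' (nth x0 s k) (nth x0 s (size s).-1).
  move=> hi hj; apply: walk_trans (hw i _ hi (leqnn _)) _.
  by apply: walk_sym => //; apply: hw hj (leqnn _).
elim: l k => [|l IH] k /andP[rk ks] hl.
  by move: hl; rewrite leqn0 subn_eq0 leqNgt ks.
have [ks1|ks1] := leqP (size s) k.+1.
  have -> : (size s).-1 = k by rewrite (_ : size s = k.+1) //; apply/eqP; rewrite eqn_leq ks1 ks.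
  exact: walk_refl.
have [p /andP[kp ps] ekp] := hs x0 k ks1.
have rp := ltn_trans rk kp.
apply: walk_trans (IH p _ _); last 2 first.
- by rewrite rp.
- by rewrite -ltnS; apply: leq_trans hl; apply: ltn_sub2l.
apply: walk_edge; rewrite /e' ekp !nth_uniq ?(ltn_trans rk) //.
by rewrite !gtn_eqF.
Qed.

End Walks.

(** * Connected and acyclic finite graphs *)

Section FiniteGraphs.
Variable T : choiceType.
Implicit Types (V : {fset T}) (E : {fset {fset T}}) (a b u v : T).

Lemma adj_sym E : ssrbool.symmetric (adj E).
Proof. by move=> u v; rewrite /adj eq_sym fsetUC. Qed.

Lemma adj_irr E : irreflexive (adj E).
Proof. by move=> u; rewrite /adj eqxx. Qed.

Lemma adj_induced E V a b :
  adj (induced_edges E V) a b = [&& adj E a b, a \in V & b \in V].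
Proof. by rewrite /adj !inE /= fsubUset !fsub1set andbA. Qed.

Lemma fset2_inj a b u v : a != b -> [fset a; b] = [fset u; v] ->
  (a = u /\ b = v) \/ (a = v /\ b = u).
Proof.
move=> ab h.
have : a \in [fset u; v] by rewrite -h !inE eqxx.
have : b \in [fset u; v] by rewrite -h !inE eqxx orbT.
rewrite !inE => /orP[]/eqP hb /orP[]/eqP ha; move: ab; rewrite ha hb ?eqxx //.
  by right.
by left.
Qed.

(** A walk back along an edge of an acyclic graph that never uses that edge
    would close up to a cycle. *)
Lemma acyclic_bridge E (e : rel T) a b : acyclic_graph E -> adj E a b ->
  subrel e (adj E) -> ~~ e b a -> ~ walk e b a.
Proof.
move=> ac ab sub nba /walk_uniq[p [pp lp up]].
have := ac (b :: p).
case: p pp lp up => [_ /= ba|c [|c' p]].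
- by move: ab; rewrite ba adj_irr.
- by rewrite /= andbT => ba ca; move: nba; rewrite -ca ba.
move=> pp lp up /(_ isT up); rewrite -[cycle _ _]/(path _ _ (rcons (c :: c' :: p) b)).
by rewrite rcons_path lp ab (sub_path sub pp).
Qed.

(** The sequence grows by the first vertex outside it on a walk to any missing
    vertex. *)
Lemma connected_order_exists E V : connected_graph V E ->
  (forall a b, adj E a b -> (a \in V) && (b \in V)) ->
  exists s, [/\ uniq s, V =i s & connected_order (adj E) s].
Proof.
move=> [/fset0Pn[v0 v0V] conn] EV.
suff build k : (0 < k)%N -> (k <= #|` V|)%N ->
    exists s, [/\ uniq s, {subset s <= V}, size s = k & connected_order (adj E) s].
  have V0 : (0 < #|` V|)%N by rewrite cardfs_gt0; apply/fset0Pn; exists v0.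
  have [s [us sV ss cs]] := build _ V0 (leqnn _).
  exists s; split=> //.
  have /(_ us sV)[] := @uniq_min_size _ s (enum_fset V).
    by rewrite ss.
  by move=> _ h x; rewrite h.
elim: k => [//|k IH] _.
case: k IH => [_ _|k IH hk].
  by exists [:: v0]; split => // x; rewrite inE => /eqP ->.
have [s [us sV ss cs]] := IH isT (ltnW hk).
have [b bV bs] : exists2 b, b \in V & b \notin s.
  apply/hasP; rewrite -[has _ _]negbK -all_predC; apply/negP => /allP h.
  have : {subset enum_fset V <= s} by move=> x /h /=; rewrite negbK.
  by move=> /(uniq_leq_size (fset_uniq V)); rewrite ss leqNgt hk.
have [a as_] : exists a, a \in s by case: s ss {us sV cs bs} => [//|a s _]; exists a; rewrite mem_head.
have : walk (adj E) a b by apply: conn => //; apply: sV.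
case=> p [+ lp]; rewrite -{}lp in bs bV *.
elim: p a as_ bs bV => [|c p IHp] a as_ /=; first by rewrite as_.
move=> bs bV /andP[ac pp]; have [cs'|cs'] := boolP (c \in s).
  exact: IHp bs bV pp.
exists (c :: s); split=> /=.
- by rewrite cs'.
- by move=> x; rewrite inE => /predU1P[->|/sV//]; case/andP: (EV _ _ ac).
- by rewrite ss.
move=> x0 [_|r] /=.
  exists (index a s).+1; first by rewrite !ltnS index_mem as_.
  by rewrite /= nth_index // adj_sym.
by rewrite ltnS => /(cs x0)[q hq eq]; exists q.+1.
Qed.

(** A walk between two vertices of a path that misses an inner vertex would,
    together with the two pieces of the path, bypass the edge that follows the
    inner vertex. *)
Lemma acyclic_path_meets E (P : pred T) u p i j k : acyclic_graph E ->
  path (adj E) u p -> uniq (u :: p) -> (i <= j)%N -> (j <= k)%N ->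
  (k <= size p)%N ->
  walk (fun c d => [&& adj E c d, P c & P d])
    (nth u (u :: p) i) (nth u (u :: p) k) ->
  P (nth u (u :: p) i) -> P (nth u (u :: p) k) -> P (nth u (u :: p) j).
Proof.
move=> ac pp up ij jk kp hw Pi Pk; set s := u :: p in pp up hw Pi Pk *.
have [->//|ij'] := eqVneq j i; have [->//|jk'] := eqVneq j k.
have {}ij : (i < j)%N by rewrite ltn_neqAle eq_sym ij' ij.
have {}jk : (j < k)%N by rewrite ltn_neqAle jk' jk.
apply: contraT => nPj.
have sp l : (l < size p)%N -> adj E (nth u s l) (nth u s l.+1).
  by move=> lp; have /pathP := pp; apply.
pose e c d := adj E c d && ([fset c; d] != [fset nth u s j; nth u s j.+1]).
have es : ssrbool.symmetric e by move=> c d; rewrite /e adj_sym fsetUC.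
have jp : (j.+1 < size s)%N by apply: leq_ltn_trans jk _; rewrite ltnS.
have along (a b : nat) : (a <= b)%N -> (b < size s)%N ->
    (b <= j)%N || (j < a)%N -> walk e (nth u s a) (nth u s b).
  move=> /subnK <-; elim: (b - a)%N => [|l IH]; first by rewrite add0n => _ _; apply: walk_refl.
  rewrite addSn => lb hj; apply: walk_trans (IH (ltnW lb) _) _.
    by case/orP: hj => [/ltnW ->|->] //; rewrite orbT.
  apply: walk_edge; rewrite /e sp // andTb; apply/eqP => /fset2_inj; case.
  - by have := sp _ lb => /andP[].
  - move=> [/eqP]; rewrite nth_uniq // ?(ltnW lb) ?(ltnW jp) // => /eqP lj _.
    by move: hj; rewrite lj ltnn /= ltnNge -lj leq_addl.
  - move=> [/eqP]; rewrite nth_uniq // ?(ltnW lb) // => /eqP lj /eqP.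
    rewrite nth_uniq // ?(ltnW jp) // => /eqP; rewrite lj => /eqP.
    by rewrite -addn2 -[X in _ == X]addn0 eqn_add2l.
have jp' : (j < size p)%N by [].
case: (@acyclic_bridge E e (nth u s j) (nth u s j.+1) ac (sp _ jp')) => //.
- by move=> c d /andP[].
- by rewrite /e fsetUC eqxx andbF.
apply: walk_trans (along j.+1 k jk _ _) _; rewrite ?ltnS ?leqnn ?orbT //.
apply: walk_trans (along i j (ltnW ij) (ltnW jp) _); last by rewrite leqnn.
apply: walk_sym => //; apply: walk_sub hw => c d /and3P[cd Pc Pd].
rewrite /e cd; apply/eqP => h.
have : nth u s j \in [fset c; d] by rewrite h !inE eqxx.
by rewrite !inE => /orP[]/eqP jc; move: nPj; rewrite jc ?Pc ?Pd.
Qed.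

End FiniteGraphs.

(** * Linear adjacency of squarefree monomials *)

Section SquarefreeSupports.
Variable n : nat.
Implicit Types (u v w b : 'X_{1..n}) (x y : 'I_n).

Lemma sqf_mnmE u x : squarefree_mon u -> u x = (x \in mvars u).
Proof. by move=> /(_ x); rewrite inE; case: (u x) => [|[|]]. Qed.

Lemma mvars_inj u v : squarefree_mon u -> squarefree_mon v ->
  mvars u = mvars v -> u = v.
Proof.
by move=> su sv h; apply/mnmP => x; rewrite (sqf_mnmE x su) (sqf_mnmE x sv) h.
Qed.

Lemma card_mvars u : squarefree_mon u -> #|mvars u| = mdeg u.
Proof.
move=> su; rewrite mdegE -sum1_card big_mkcond /=.
by apply: eq_bigr => x _; rewrite (sqf_mnmE x su); case: (x \in _).
Qed.

Lemma mvars_sub_eq u v : squarefree_mon u -> squarefree_mon v ->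
  mdeg u = mdeg v -> mvars u \subset mvars v -> u = v.
Proof.
move=> su sv duv suv; apply: mvars_inj => //; apply/eqP.
by rewrite eqEcard suv !card_mvars // duv leqnn.
Qed.

Lemma lin_adj_sym : ssrbool.symmetric (@lin_adj n).
Proof.
move=> u v; rewrite /lin_adj eq_sym; congr andb.
by apply/existsP/existsP => -[x /existsP[y /eqP h]]; exists y; apply/existsP; exists x; rewrite h.
Qed.

Lemma lin_adjP u v : reflect (u <> v /\ exists x y, (U_(x) + u = U_(y) + v)%MM)
  (lin_adj u v).
Proof.
apply: (iffP andP) => -[/eqP uv].
  by move=> /existsP[x /existsP[y /eqP h]]; split=> //; exists x, y.
by move=> [x [y h]]; split=> //; apply/existsP; exists x; apply/existsP; exists y; rewrite h.
Qed.

Lemma lin_supports b w x y : squarefree_mon b -> squarefree_mon w -> b <> w ->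
  (U_(x) + b = U_(y) + w)%MM ->
  [/\ x \notin mvars b, x \in mvars w & mvars b :|: mvars w = x |: mvars b].
Proof.
move=> sb sw bw h.
have hi i : ((x == i) + b i = (y == i) + w i)%N.
  by have := congr1 (fun m : 'X_{1..n} => m i) h; rewrite !mnmDE !mnm1E.
have xy : x != y.
  by apply: contra_notN bw => /eqP xy; apply/mnmP => i; have := hi i; rewrite xy => /addnI.
have hx := hi x; rewrite eqxx eq_sym (negbTE xy) add0n in hx.
have wx := sw x; rewrite -hx add1n ltnS leqn0 in wx.
have xb : x \notin mvars b by rewrite inE (eqP wx).
have xw : x \in mvars w by rewrite inE -hx.
split=> //; apply/setP => i; rewrite !inE.
have := hi i; have [<-|nxi] := eqVneq x i; first by move: xw; rewrite inE => -> _; rewrite orbT.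
by rewrite /= add0n => ->; case: (y == i); case: (w i).
Qed.

(** Each of the two monomials arises from the product of the variables in
    [x |: mvars b] by leaving out a single variable. *)
Lemma lin_adj_supports b z x : squarefree_mon b -> squarefree_mon z ->
  mdeg b = mdeg z -> b <> z -> x \notin mvars b -> mvars z \subset x |: mvars b ->
  lin_adj b z /\ mvars b :|: mvars z = x |: mvars b.
Proof.
move=> sb sz dbz bz xb zM.
have xz : x \in mvars z.
  apply: contra_notT bz => xz; apply/esym/mvars_sub_eq => //.
  apply/subsetP => i iz; have := subsetP zM i iz; rewrite in_setU1.
  by case/predU1P => // ix; move: xz; rewrite -ix iz.
have [y yb yz] : exists2 y, y \in mvars b & y \notin mvars z.
  apply/subsetPn; apply: contra_notN bz; exact: mvars_sub_eq.
have ez : mvars z = x |: (mvars b :\ y).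
  apply/eqP; rewrite eqEcard; apply/andP; split.
    apply/subsetP => i iz; have := subsetP zM i iz; rewrite !inE.
    by case/orP => [->//|->]; rewrite andbT; apply/orP; right; apply: contraNneq yz => <-.
  rewrite cardsU1 in_setD1 (negbTE xb) andbF /= card_mvars // -dbz -card_mvars //.
  by rewrite (cardsD1 y (mvars b)) yb.
split; last by apply/setP => i; rewrite ez !inE; case: (i == x); case: (0 < b i)%N; rewrite ?orbT ?andbF.
apply/lin_adjP; split=> //; exists x, y; apply/mnmP => i.
rewrite !mnmDE !mnm1E (sqf_mnmE i sb) (sqf_mnmE i sz) ez in_setU1 in_setD1.
rewrite [i == x]eq_sym [i == y]eq_sym.
have [<-|_] := eqVneq x i; first by rewrite (negbTE xb) andbF; case: eqVneq xb => // <-; rewrite yb.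
by have [<-|_] := eqVneq y i; rewrite ?yb.
Qed.

End SquarefreeSupports.

(** * Edge types and the first syzygy graph *)

Section LinearGraph.
Variable n : nat.
Implicit Types (G H V : {fset 'X_{1..n}}) (E : {fset {fset 'X_{1..n}}}).
Implicit Types (a b c u v w : 'X_{1..n}) (x y : 'I_n) (M : {set 'I_n}).

Lemma adj_lin G a b : adj (lin_edges G) a b = [&& a \in G, b \in G & lin_adj a b].
Proof.
rewrite /adj; apply/andP/and3P => [[ab /imfset2P]|[aG bG lab]].
  case=> u /= uG [v /= ]; rewrite !inE => /andP[vG uv] /(fset2_inj ab).
  by case=> -[-> ->]; split=> //; rewrite lin_adj_sym.
split; first by case/andP: lab.
by apply/imfset2P; exists a => //; exists b => //; rewrite !inE bG.
Qed.

Lemma reduction_sub G E a b : reduction G E -> adj E a b -> adj (lin_edges G) a b.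
Proof.
move=> red; elim: red a b => [//|{}E a b c _ IH _ u v].
by rewrite /adj in_fsetD1 => /andP[uv /andP[_ h]]; apply: IH; rewrite /adj uv.
Qed.

Lemma reduction_vertices G E a b :
  reduction G E -> adj E a b -> (a \in G) && (b \in G).
Proof. by move=> red /(reduction_sub red); rewrite adj_lin => /and3P[-> ->]. Qed.

(** The type [M] is the support of the lcm of the two ends, which is the
    multidegree of the linear relation of the edge. *)
Definition type_adj E M : rel 'X_{1..n} :=
  fun a b => adj E a b && (mvars a :|: mvars b == M).

Lemma type_adj_sym E M : ssrbool.symmetric (type_adj E M).
Proof. by move=> a b; rewrite /type_adj adj_sym setUC. Qed.

(** The three edges of a triangle of type (i) have the same type, so that the
    two remaining ones make up for the deleted one. *)
Lemma reduction_walk G E a b : reduction G E -> adj (lin_edges G) a b ->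
  walk (type_adj E (mvars a :|: mvars b)) a b.
Proof.
move=> red ab; elim: red => [|{}E p q r _ IH]; first by apply/walk_edge/andP.
set M := _ :|: _ in IH *.
move=> [pq qr pr [A [i [j [k [_ _ [mp mq mr]]]]]]].
have [M1 M2 M3] : [/\ mvars p :|: mvars q = A :|: [set i; j; k],
    mvars q :|: mvars r = A :|: [set i; j; k] & mvars p :|: mvars r = A :|: [set i; j; k]].
  by split; rewrite ?mp ?mq ?mr; apply/setP => t; rewrite !inE;
     do ![case: (_ == _) => //=]; rewrite ?orbT ?orbF ?orbb.
have np : p != r by case/andP: pr.
have nq : q != r by case/andP: qr.
have keep c d : adj E c d -> (r == c) || (r == d) -> adj (E `\ [fset p; q]) c d.
  move=> /andP[cd ecd] rcd; rewrite /adj cd in_fsetD1 ecd andbT.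
  apply/eqP => h; have : r \in [fset c; d] by rewrite !inE.
  by rewrite h !inE ![r == _]eq_sym (negbTE np) (negbTE nq).
apply: walk_bind IH => c d /andP[cd /eqP tcd].
have [h|h] := eqVneq [fset c; d] [fset p; q]; last first.
  by apply: walk_edge; move: cd; rewrite /type_adj tcd eqxx andbT /adj in_fsetD1 h.
have cd' : c != d by case/andP: cd.
have pqM : walk (type_adj (E `\ [fset p; q]) M) p q.
  have eM : M = A :|: [set i; j; k].
    by rewrite -tcd -M1; case: (fset2_inj cd' h) => -[-> ->] //; rewrite setUC.
  apply: (@walk_trans _ _ r).
    by apply: walk_edge; rewrite /type_adj keep ?eqxx ?orbT // M3 eM eqxx.
  by apply: walk_edge; rewrite /type_adj keep ?eqxx // 1?adj_sym // setUC M2 eM eqxx.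
case: (fset2_inj cd' h) => -[-> ->] //.
by apply: walk_sym => //; apply: type_adj_sym.
Qed.

Lemma btwP G u v w : (w \in between G u v) =
  (w \in G) && (mvars w \subset mvars u :|: mvars v).
Proof. by rewrite !inE. Qed.

(** Let [G] have an acyclic first syzygy graph and let [x b = y w] be a linear
    relation. Deleting the edges of its type separates [b] from all monomials
    reached from [w] without passing through [b]; on the other hand an edge of
    that type has an end divisible by [x], so these edges cannot occur on a walk
    through divisors of [lcm(a, b)] when [x] does not divide [a]. *)
Lemma divides_of_btw_walk G E d a b w x y :
  (forall u, u \in G -> squarefree_mon u) -> (forall u, u \in G -> mdeg u = d) ->
  reduction G E -> acyclic_graph E ->
  adj (lin_edges G) b w -> (U_(x) + b = U_(y) + w)%MM ->
  walk (fun c c' => [&& adj (lin_edges G) c c', c != b & c' != b]) w a ->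
  walk (adj (induced_edges (lin_edges G) (between G a b))) a b ->
  x \in mvars a.
Proof.
move=> sqf deg red acyc bw xbyw wa ab.
have /and3P[bG wG /lin_adjP[nbw _]] : [&& b \in G, w \in G & lin_adj b w] by rewrite -adj_lin.
have [xb xw tbw] := lin_supports (sqf _ bG) (sqf _ wG) nbw xbyw.
set M := x |: mvars b in tbw.
pose e c c' := adj E c c' && (mvars c :|: mvars c' != M).
have step c c' : adj (lin_edges G) c c' -> mvars c :|: mvars c' != M ->
    walk e b c -> walk e b c'.
  move=> cc' tcc' /walk_trans; apply; apply: walk_sub (reduction_walk red cc').
  by move=> p q /andP[pq /eqP tpq]; rewrite /e pq tpq.
(* The clique of type [M] joins [b] to [z] by edges of type [M]; the first of them
   is a bridge, so no walk without such edges leads back from [z] to [b]. *)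
have sep z : z \in G -> z <> b -> mvars z \subset M -> ~ walk e b z.
  move=> zG zb zM bz.
  have [lbz tbz] : lin_adj b z /\ mvars b :|: mvars z = M.
    by apply: lin_adj_supports; rewrite ?(deg _ bG) ?(deg _ zG) //; [apply: sqf|apply: sqf|exact: nesym].
  have : adj (lin_edges G) b z by rewrite adj_lin bG zG.
  move=> /(reduction_walk red); rewrite tbz => /walk_uniq[[|z1 p] []].
    by move=> _ /= bz' _; apply: zb.
  rewrite [path _ _ _]/= [last _ _]/= => /andP[/andP[bz1 /eqP tbz1] pp] lp.
  rewrite cons_uniq => /andP[bp _].
  apply: (@acyclic_bridge _ E (fun c c' => adj E c c' && ([fset c; c'] != [fset b; z1])) b z1 acyc bz1).
  - by move=> c c' /andP[].
  - by rewrite fsetUC eqxx andbF.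
  apply: (@walk_trans _ _ z).
    exists p; split=> //.
    apply: sub_path (path_all (P := predC1 b) pp _).
      move=> c c' /and3P[/andP[cc' _] cb cb']; rewrite cc' /=.
      apply/eqP => h; have : b \in [fset c; c'] by rewrite h !inE eqxx.
      by move: cb cb'; rewrite !inE ![b == _]eq_sym => /negbTE -> /negbTE ->.
    by apply/allP => c cp; apply: contraNneq bp => <-.
  apply: walk_sym; first by move=> c c'; rewrite adj_sym fsetUC.
  apply: walk_sub bz => c c' /andP[cc' tcc']; rewrite cc' /=.
  apply: contraNneq tcc' => /fset2_inj; case; first by case/andP: cc'.
    by move=> [-> ->]; rewrite tbz1.
  by move=> [-> ->]; rewrite setUC tbz1.
(* Non-reachability from [b] passes along [w], ..., [a]: a step of type [M] ends
   in the clique of [b], but not at [b]. *)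
have nw : ~ walk e b w by refine (sep w wG (nesym nbw) _); rewrite -tbw subsetUr.
have na : ~ walk e b a.
  move: nw; refine (walk_closed (P := fun c => ~ walk e b c) _ wa) => c c' /and3P[cc' cb cb'] nc.
  have /and3P[cG c'G _] : [&& c \in G, c' \in G & lin_adj c c'] by rewrite -adj_lin.
  have [t|t] := eqVneq (mvars c :|: mvars c') M.
    by refine (sep c' c'G _ _); [exact/eqP|rewrite -t subsetUr].
  by apply: contra_not nc; apply: step; rewrite 1?adj_sym // setUC.
apply: contraT => xa; case: na.
apply: (walk_closed (P := walk e b) _ (walk_sym (@adj_sym _ _) ab)); last exact: walk_refl.
move=> c c'; rewrite adj_induced !btwP => /and3P[cc' /andP[cG cM] /andP[c'G c'M]].
apply: step => //; apply/eqP => t.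
(* In the clique of type [M] only [b] is prime to [x], so no edge has two such
   ends. *)
have nx z : z \in G -> mvars z \subset mvars a :|: mvars b -> mvars z \subset M -> z = b.
  move=> zG zab zM; apply: mvars_sub_eq; rewrite ?deg //; try exact: sqf.
  apply/subsetP => i iz; have := subsetP zM i iz; rewrite in_setU1.
  case/predU1P => // ix; have := subsetP zab i iz.
  by rewrite ix in_setU (negbTE xa) (negbTE xb).
have /andP[/eqP[]] := cc'.
by rewrite (nx c) // -?t ?subsetUl // (nx c') // -?t ?subsetUr.
Qed.

End LinearGraph.

(** * Coefficients and monomial ideals *)

Section Coefficients.
Local Open Scope ring_scope.
Variables (K : fieldType) (n : nat).
Implicit Types (p q f : {mpoly K[n]}) (m k u w : 'X_{1..n}) (H : {fset 'X_{1..n}}).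

Lemma mcoeffMX_le p m k :
  (p * 'X_[m])@_k = if (m <= k)%MM then p@_(k - m) else 0.
Proof.
case: ifP => [mk|mk]; first by rewrite -{1}(submK mk) addmC mcoeffMX.
apply: memN_msupp_eq0; rewrite (perm_mem (msuppMX p m)); apply/negP.
by case/mapP => m' _ e; move: mk; rewrite e lem_addr.
Qed.

Lemma lem_mdeg_eq m k : (m <= k)%MM -> mdeg m = mdeg k -> m = k.
Proof.
move=> /submK mk e; have := congr1 (@mdeg n) mk; rewrite mdegD e.
move=> /eqP; rewrite -[X in _ == X]add0n eqn_add2r mdeg_eq0 => /eqP z.
by rewrite -mk z add0m.
Qed.

Lemma mcoeffMX_deg p m k : mdeg m = mdeg k ->
  (p * 'X_[m])@_k = p@_0%MM * (m == k)%:R.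
Proof.
move=> e; rewrite mcoeffMX_le; case: ifP => [mk|/negP mk].
  by rewrite (lem_mdeg_eq mk e) eqxx mulr1 -{1}[k]add0m addmK.
by case: eqP => [mk'|_]; rewrite ?mulr0 //; case: mk; rewrite mk' lepm_refl.
Qed.

Lemma mcoeffM_homog d p q k : q \is d.-homog -> mdeg k = d ->
  (p * q)@_k = p@_0%MM * q@_k.
Proof.
move=> /dhomogP hq kd; rewrite {1}[q]mpolyE mulr_sumr raddf_sum /=.
rewrite [X in _ = _ * X@__]mpolyE raddf_sum /= mulr_sumr.
apply: eq_big_seq => m /hq /= md.
by rewrite -scalerAr !mcoeffZ mcoeffMX_deg ?md ?kd // mcoeffX mulrCA.
Qed.

Lemma mon_ideal_gen H u : u \in H -> mon_ideal H ('X_[u] : {mpoly K[n]}).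
Proof.
move=> uH; exists (fun w => (w == u)%:R).
rewrite (bigD1_seq u) ?fset_uniq //= eqxx mul1r big1 ?addr0 // => w /negbTE ->.
by rewrite mul0r.
Qed.

Lemma mon_ideal_seq (s : seq 'X_{1..n}) x0 H f : uniq s -> H =i s ->
  mon_ideal H f <->
  exists v : 'I_(size s) -> {mpoly K[n]}, f = \sum_i v i * 'X_[nth x0 s i].
Proof.
move=> us Hs; have ps : perm_eq H s by apply: uniq_perm; rewrite ?fset_uniq.
split=> [[c ->]|[v ->]].
  exists (fun i => c (nth x0 s i)); rewrite (perm_big _ ps) /=.
  by rewrite (big_nth x0) big_mkord.
case: s v us {Hs} ps => [|a s] v us ps.
  exists (fun=> 0); rewrite (perm_big _ ps) big_ord0.
  by rewrite big_nil.
exists (fun w => v (inord (index w (a :: s)))); rewrite (perm_big _ ps).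
rewrite (big_nth x0) big_mkord; apply: eq_bigr => i _.
by rewrite index_uniq // inord_val.
Qed.

(** In the degree of the generators only the constant terms of the coefficients
    contribute. *)
Lemma mon_ideal_homog d H f : (forall u, u \in H -> mdeg u = d) ->
  mon_ideal H f -> f \is d.-homog -> f = \sum_(u : H) f@_(val u) *: 'X_[val u].
Proof.
move=> hd fH hf; apply/mpolyP => k.
rewrite [RHS]raddf_sum /=; have [kd|kd] := eqVneq (mdeg k) d; last first.
  rewrite (dhomog_nemf_coeff hf kd) big1 // => u _.
  rewrite mcoeffZ mcoeffX; case: eqP => [uk|]; last by rewrite mulr0.
  by move: kd; rewrite -uk hd ?eqxx // (valP u).
have [kH|kH] := boolP (k \in H).
  rewrite (bigD1 [` kH]) //= mcoeffZ mcoeffX eqxx mulr1 big1 ?addr0 // => u uk.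
  rewrite mcoeffZ mcoeffX; case: eqP => [e|]; last by rewrite mulr0.
  by case/eqP: uk; apply: val_inj.
rewrite [RHS]big1 => [|u _]; last first.
  rewrite mcoeffZ mcoeffX; case: eqP => [e|]; last by rewrite mulr0.
  by move: kH; rewrite -e (valP u).
have [c ->] := fH; rewrite raddf_sum big_seq big1 //= => u uH.
rewrite (mcoeffMX_deg _ (etrans (hd _ uH) (esym kd))).
by case: eqP => [e|]; [move: kH; rewrite -e uH|rewrite mulr0].
Qed.

Lemma mon_ideal_min_gens d H : (forall u, u \in H -> mdeg u = d) ->
  is_min_mon_gens (mon_ideal (K := K) H) H.
Proof.
move=> hd; split=> // H' /andP[/fsubsetP sub /fsubsetPn[u uH uH']] h.
have [c hc] := (h _).1 (mon_ideal_gen uH).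
have := congr1 (mcoeff u) hc; rewrite mcoeffX eqxx raddf_sum big_seq big1 /=.
  by move/eqP; rewrite oner_eq0.
move=> w wH'; rewrite mcoeffMX_deg; last by rewrite !hd // sub.
by case: eqP => [e|]; rewrite ?mulr0 //; move: uH'; rewrite -e wH'.
Qed.

Lemma mpolyX_eq0 m : ('X_[m] == 0 :> {mpoly K[n]}) = false.
Proof.
apply/eqP => /(congr1 (mcoeff m)); rewrite mcoeffX eqxx mcoeff0.
by move/eqP; rewrite oner_eq0.
Qed.

Lemma mpoly_divX p x : (forall m, m x = 0%N -> p@_m = 0) ->
  exists c, p = c * 'X_x.
Proof.
move=> h; exists (\sum_(m <- msupp p) p@_m *: 'X_[m - U_(x)]).
rewrite {1}[p]mpolyE mulr_suml; apply: eq_big_seq => m; rewrite mcoeff_msupp => pm.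
rewrite -scalerAl -mpolyXD submK //; apply/mnm_lepP => i; rewrite mnm1E.
case: eqP => // <-; rewrite lt0n; apply: contraNneq pm => mx.
by rewrite h.
Qed.

End Coefficients.

(** * Resolutions of length one from principal colon ideals *)

Section LinearQuotients.
Local Open Scope ring_scope.
Variables (K : fieldType) (n : nat).

Definition length1_rank m i := if i is 0%N then m.+1 else if i is 1%N then m else 0%N.

(** The basis elements in homological degree [i] get degree [d + i], as they must
    in a linear resolution of an ideal generated in degree [d]. *)
Definition length1_seq d m (D : 'M[{mpoly K[n]}]_(m, m.+1))
    (a : 'cV[{mpoly K[n]}]_m.+1) : graded_free_seq K n :=
  @GradedFreeSeq K n (length1_rank m) (fun i _ => (d + i)%N)
    (fun i => if i is 0%N return 'M_(length1_rank m i.+1, length1_rank m i)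
              then D else 0) a.

(** Every monomial [U r] of the list but the last has a linear relation
    [x r * U r = y r * U (px r)] with a later one, where the variable [x r] divides
    all later monomials but not [U r]. *)
Section Order.
Variables (m d : nat) (s : seq 'X_{1..n}) (x0 : 'X_{1..n}).
Hypothesis ss : size s = m.+1.
Hypothesis sdeg : forall u, u \in s -> mdeg u = d.
Variables (px : 'I_m -> nat) (x y : 'I_m -> 'I_n).
Let U i := nth x0 s i.
Hypothesis px_gt : forall r : 'I_m, (r < px r < m.+1)%N.
Hypothesis relE : forall r : 'I_m, (U_(x r) + U r = U_(y r) + U (px r))%MM.
Hypothesis x_notin : forall r : 'I_m, U r (x r) = 0%N.
Hypothesis x_in : forall (r : 'I_m) j, (r < j < m.+1)%N -> (0 < U j (x r))%N.

Let D : 'M[{mpoly K[n]}]_(m, m.+1) := \matrix_(r, i)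
  (((i == r :> nat)%:R * 'X_(x r)) - ((i == px r :> nat)%:R * 'X_(y r))).
Let a : 'cV[{mpoly K[n]}]_m.+1 := \col_i 'X_[U i].

Lemma leading_entry (r : 'I_m) : D r (widen_ord (leqnSn m) r) = 'X_(x r).
Proof.
rewrite mxE /= eqxx mul1r; have /andP[rp _] := px_gt r.
by rewrite ltn_eqF // mul0r subr0.
Qed.

Lemma entry_before (r : 'I_m) (i : 'I_m.+1) : (i < r)%N -> D r i = 0.
Proof.
move=> ir; have /andP[rp _] := px_gt r.
by rewrite mxE (ltn_eqF ir) (ltn_eqF (ltn_trans ir rp)) !mul0r subr0.
Qed.

Lemma relations_syzygy : D *m a = 0.
Proof.
apply/matrixP => r c; rewrite !mxE.
have /andP[rp pm] := px_gt r.
under eq_bigr => i _ do rewrite !mxE mulrBl.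
rewrite sumrB (bigD1 (widen_ord (leqnSn m) r)) //= eqxx mul1r big1 ?addr0; last first.
  by move=> i; rewrite -val_eqE /= => /negbTE ->; rewrite !mul0r.
rewrite (bigD1 (Ordinal pm)) //= eqxx mul1r big1 ?addr0; last first.
  by move=> i; rewrite -val_eqE /= => /negbTE ->; rewrite !mul0r.
by rewrite -!mpolyXD relE subrr.
Qed.

(** The matrix [D] is upper triangular with the variables [x r] on its diagonal. *)
Lemma relations_free (w : 'rV_m) : w *m D = 0 -> w = 0.
Proof.
move=> wD; suff h k (r : 'I_m) : (r < k)%N -> w 0 r = 0.
  by apply/rowP => r; rewrite mxE; apply: (h m).
elim: k r => [//|k IH] r; rewrite ltnS => rk.
have := congr1 (fun v : 'rV_m.+1 => v 0 (widen_ord (leqnSn m) r)) wD.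
rewrite !mxE (bigD1 r) //= leading_entry big1 ?addr0 => [/eqP|i ir].
  by rewrite mulf_eq0 => /orP[/eqP //|]; rewrite mpolyX_eq0.
have [ri|ri] := ltnP r i; first by rewrite entry_before ?mulr0.
rewrite IH ?mul0r //; apply: leq_trans rk; rewrite ltn_neqAle ri andbT.
by rewrite val_eqE.
Qed.

(** The colon ideal of the later monomials by the [r]-th one is [(x r)]: so the
    first nonzero coefficient of a syzygy is a multiple of [x r] and can be
    cancelled by the [r]-th relation. *)
Lemma relations_generate (v : 'rV_m.+1) : v *m a = 0 -> exists w, v = w *m D.
Proof.
(* Induction on the number [k] of entries that follow the leading zeros. *)
suff h k : (k <= m.+1)%N -> forall v : 'rV[{mpoly K[n]}]_m.+1, v *m a = 0 ->
    (forall i : 'I_m.+1, (i < m.+1 - k)%N -> v 0 i = 0) -> exists w, v = w *m D.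
  by move=> va; apply: (h m.+1) => // i; rewrite subnn.
elim: k => [_ {}v _ v0|k IH km {}v va v0].
  exists 0; rewrite mul0mx; apply/rowP => i; rewrite mxE v0 // subn0; exact: ltn_ord.
set r := (m.+1 - k.+1)%N in v0; rewrite subSS in r v0.
have rm : (r < m.+1)%N by rewrite ltnS leq_subr.
have rk : (m.+1 - k)%N = r.+1 by rewrite subSn.
have va0 : \sum_(i < m.+1) v 0 i * 'X_[U i] = 0.
  have := congr1 (fun c : 'cV[{mpoly K[n]}]_1 => c 0 0) va.
  rewrite mxE [in RHS]mxE => e; apply: etrans e.
  by apply: eq_bigr => i _; rewrite mxE.
have rest (i : 'I_m.+1) : i != Ordinal rm -> ~~ (r < i)%N -> v 0 i = 0.
  rewrite -val_eqE /= -leqNgt => ir ri; apply: v0.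
  by rewrite ltn_neqAle ir.
(* If only the last entry is left, it vanishes as a factor of zero. *)
have [rlt|rge] := ltnP r m; last first.
  apply: (IH (ltnW km)) => // i; rewrite rk ltnS leq_eqVlt => /orP[/eqP ir|/v0//].
  move: va0; rewrite (bigD1 i) //= big1 ?addr0 => [/eqP|j ji].
    by rewrite mulf_eq0 mpolyX_eq0 orbF => /eqP.
  rewrite rest ?mul0r //.
    by move: ji; rewrite -!val_eqE /= ir.
  by rewrite -leqNgt; apply: leq_trans rge; rewrite -ltnS.
pose r' := Ordinal rlt.
have [c hc] : exists c, v 0 (Ordinal rm) = c * 'X_(x r').
  apply: mpoly_divX => q qx.
  have := congr1 (mcoeff (q + U r)) va0; rewrite mcoeff0 raddf_sum (bigD1 (Ordinal rm)) //=.
  rewrite addmC mcoeffMX big1 ?addr0 // => i ir.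
  have [ri|ri] := ltnP r i; last by rewrite rest ?mul0r ?mcoeff0 // -leqNgt.
  rewrite mcoeffMX_le; case: ifP => // /mnm_lepP/(_ (x r')).
  rewrite mnmDE qx (x_notin r') leqn0 => /eqP h.
  by have := @x_in r' i; rewrite h ri ltn_ord => /(_ isT).
have [w hw] : exists w, v - c *: row r' D = w *m D.
  apply: (IH (ltnW km)).
    by rewrite mulmxBl va -scalemxAl -row_mul relations_syzygy row0 scaler0 subrr.
  move=> i; rewrite rk ltnS leq_eqVlt => /orP[/eqP ir|ir]; rewrite !mxE.
    have -> : i = Ordinal rm by apply: val_inj.
    have := leading_entry r'; rewrite mxE /= => e.
    by rewrite hc e subrr.
  have := @entry_before r' i ir; rewrite mxE => ->.
  by rewrite v0 // mulr0 subrr.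
exists (w + c *: delta_mx 0 r'); rewrite mulmxDl -hw -scalemxAl -rowE.
by rewrite subrK.
Qed.

Lemma linear_quotients_resolution (H : {fset 'X_{1..n}}) (L : {mpoly K[n]} -> Prop) :
  uniq s -> H =i s -> (forall f, L f <-> mon_ideal H f) ->
  has_linear_resolution d L.
Proof.
move=> us Hs hL; exists (length1_seq d D a); split; last by [].
split.
- split=> [j|i r c] /=; rewrite /homog_entry.
    by rewrite leq0n subn0 addn0 mxE dhomogX /= sdeg // mem_nth // ss.
  rewrite leq_add2l leqnSn subnDl subSnn; case: i r c => [|i] r c; last first.
    by rewrite mxE dhomog0.
  rewrite mxE; apply: dhomogD; rewrite ?dhomogN.
    by case: eqP => _; rewrite ?mul1r ?mul0r ?dhomog0 // dhomogX /= mdeg1.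
  by case: eqP => _; rewrite ?mul1r ?mul0r ?dhomog0 // dhomogX /= mdeg1.
- case=> [|i] r c /=; rewrite mxE ?mcoeff0 // mcoeffB.
  by rewrite !mulr_natl !mcoeffMn !mcoeffX !mnm1_eq0 !mul0rn subrr.
- move=> f; rewrite hL (mon_ideal_seq x0 f us Hs) ss; split=> [[v ->]|[v ->]].
    exists (\row_i v i); rewrite mxE; apply: eq_bigr => i _.
    by rewrite !mxE.
  by exists (fun i => v 0 i); rewrite mxE; apply: eq_bigr => i _; rewrite mxE.
- split=> [v|i v] /=.
    split=> [/relations_generate//|[w ->]].
    by rewrite -mulmxA relations_syzygy mulmx0.
  case: i v => [|i] v /=.
    split=> [/relations_free ->|[w ->]]; first by exists 0; rewrite mul0mx.
    by rewrite mulmx0 mul0mx.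
  by split=> [_|_]; [exists 0; rewrite mul0mx; apply/rowP => -[]|rewrite mulmx0].
- by exists 1%N => -[|[|i]].
Qed.

End Order.
End LinearQuotients.

(** * From linear resolutions to connectedness *)

Section LinearRelations.
Local Open Scope ring_scope.
Variables (K : fieldType) (n : nat) (H : {fset 'X_{1..n}}).
Implicit Types (f : {ffun H -> {mpoly K[n]}}).

(** A generating family is cut down, as long as a proper subfamily generates. *)
Lemma minimal_linear_generators q (r : 'I_q -> {ffun H -> {mpoly K[n]}}) :
  (forall j, linear_syzygy (r j)) ->
  (forall f, phi f = 0 <-> in_poly_span r [set: 'I_q] f) ->
  has_linear_relations K H.
Proof.
move: {2}q (leqnn q) => N; elim: N q r => [|N IH] q r qN lin gen.
  exists q, r; split=> // J /proper_card; rewrite cardsT card_ord => lt _.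
  by move: (leq_trans lt qN).
have [[J [Jp Jg]]|nJ] := classic (exists J : {set 'I_q}, J \proper [set: 'I_q] /\
    (forall f, phi f = 0 <-> in_poly_span r J f)); last first.
  by exists q, r; split=> // J Jp Jg; apply: nJ; exists J.
apply: (IH #|J| (fun j => r (enum_val j))) => // [|f].
  by rewrite -ltnS; apply: leq_trans qN; move/proper_card: Jp; rewrite cardsT card_ord.
rewrite Jg; split=> -[c hc].
  exists (fun j => c (enum_val j)) => u; rewrite hc big_enum_val.
  by apply: eq_bigl => j; rewrite inE.
have [J0|/set0Pn[j1 j1J]] := eqVneq J set0.
  exists (fun=> 0) => u; rewrite hc [RHS]big1 => [|j _]; last by rewrite mul0r.
  by rewrite big1 // => j _; have := enum_valP j; move/setP: J0 => ->; rewrite inE.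
exists (fun i => c (enum_rank_in j1J i)) => u; rewrite hc [RHS]big_enum_val.
by apply: eq_big => [j|j _]; rewrite ?inE // enum_valK_in.
Qed.

(** A change of basis: in degree [d] the entries of the augmentation and the
    monomials of [H] are combinations of each other with scalar coefficients, so
    the linear first differential turns into linear relations on [H]. *)
Lemma linear_resolution_relations d (L : {mpoly K[n]} -> Prop) :
  (forall p, L p <-> mon_ideal H p) -> (forall u, u \in H -> mdeg u = d) ->
  has_linear_resolution d L -> has_linear_relations K H.
Proof.
move=> hL hd [C [[[hom0 hom] _ gen [ex0 _] _] sh]].
pose F j := augm C j ord0.
have Fhom j : F j \is d.-homog.
  by have := hom0 j; rewrite /homog_entry leq0n subn0 sh addn0.
have FA j : F j = \sum_(u : H) (F j)@_(val u) *: 'X_[val u].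
  apply: mon_ideal_homog (Fhom j) => //; apply/hL/gen.
  by exists (delta_mx 0 j); rewrite -rowE mxE.
have [B hB] : exists B : H -> 'I_(rank C 0) -> K,
    forall u, 'X_[val u] = \sum_j B u j *: F j.
  apply: (@fin_all_exists _ _ (fun u (b : 'I_(rank C 0) -> K) =>
    'X_[val u] = \sum_j b j *: F j)) => u.
  have /hL/gen[v hv] : mon_ideal (K := K) H 'X_[val u] by apply: mon_ideal_gen; apply: valP.
  exists (fun j => (v 0 j)@_0%MM); apply/mpolyP => k.
  have [kd|kd] := eqVneq (mdeg k) d.
    rewrite hv mxE !raddf_sum /=; apply: eq_bigr => j _.
    by rewrite (mcoeffM_homog _ (Fhom j) kd) mcoeffZ.
  rewrite raddf_sum big1 /= => [|j _]; last first.
    by rewrite mcoeffZ (dhomog_nemf_coeff (Fhom j) kd) mulr0.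
  rewrite mcoeffX; case: eqP => // e; move: kd; rewrite -e hd ?eqxx //; exact: valP.
(* [B] and the coefficients of [F] are inverse to each other on the side on which
   they compose to a transformation of the monomials, which are independent. *)
have BA (u w : H) : \sum_j B u j * (F j)@_(val w) = (u == w)%:R.
  have := congr1 (mcoeff (val w)) (hB u); rewrite mcoeffX val_eqE => ->.
  by rewrite raddf_sum; apply: eq_bigr => j _; rewrite /= mcoeffZ.
pose r (k : 'I_(rank C 1)) : {ffun H -> {mpoly K[n]}} :=
  [ffun u => \sum_j (F j)@_(val u) *: diff C 0 k j].
have rphi k : phi (r k) = 0.
  have -> : phi (r k) = \sum_j diff C 0 k j * F j.
    rewrite /phi; under eq_bigr => u _ do rewrite ffunE mulr_suml.
    rewrite exchange_big /=; apply: eq_bigr => j _; rewrite {2}FA mulr_sumr.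
    by apply: eq_bigr => u _; rewrite -scalerAl -scalerAr.
  have : row k (diff C 0) *m augm C = 0.
    by apply/ex0; exists (delta_mx 0 k); rewrite -rowE.
  move/matrixP/(_ ord0 ord0); rewrite !mxE => e; apply: etrans e.
  by apply: eq_bigr => j _; rewrite mxE.
apply: (@minimal_linear_generators _ r) => [k|f].
  split=> [|u]; first exact: rphi.
  rewrite ffunE; apply: rpred_sum => j _; apply: dhomogZ.
  by have := hom 0%N k j; rewrite /homog_entry !sh leq_add2l leqnSn subnDl subSnn.
split=> [hf|[c hc]]; last first.
  rewrite /phi; under eq_bigr => u _ do rewrite hc mulr_suml.
  rewrite exchange_big /= big1 // => k _; transitivity (c k * phi (r k)).
    by rewrite mulr_sumr; apply: eq_bigr => u _; rewrite mulrA.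
  by rewrite rphi mulr0.
pose V : 'rV[{mpoly K[n]}]_(rank C 0) := \row_j \sum_(u : H) B u j *: f u.
have [w hw] : exists w, V = w *m diff C 0.
  apply/ex0/matrixP => i0 j0; rewrite !ord1 !mxE.
  transitivity (phi f); last exact: hf.
  under eq_bigr => j _ do rewrite mxE mulr_suml.
  rewrite exchange_big /=; apply: eq_bigr => u _; rewrite hB mulr_sumr.
  by apply: eq_bigr => j _; rewrite -scalerAl -scalerAr.
exists (fun k => w 0 k) => u.
transitivity (\sum_j (F j)@_(val u) *: V 0 j).
  under eq_bigr => j _ do rewrite mxE scaler_sumr.
  rewrite exchange_big (bigD1 u) //= [X in _ + X]big1 => [|u' u'u].
    rewrite addr0; under eq_bigr => j _ do rewrite scalerA mulrC.
    by rewrite -scaler_suml BA eqxx scale1r.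
  under eq_bigr => j _ do rewrite scalerA mulrC.
  by rewrite -scaler_suml BA (negbTE u'u) scale0r.
rewrite hw; under eq_bigr => j _ do rewrite mxE scaler_sumr.
rewrite exchange_big; apply: eq_big => [k|k _] /=; first by rewrite inE.
by rewrite ffunE mulr_sumr; apply: eq_bigr => j _; rewrite scalerAr.
Qed.

(** The test functional: for an exponent [m] and a set [Z] of generators, add up
    the coefficients of multidegree [m] at the basis elements in [Z]. If [Z] is a
    connected component among the divisors of [m], it vanishes on all multiples
    of edge relations, but not on the syzygy of two monomials that [Z] separates. *)
Definition component_coeff (m : 'X_{1..n}) (Z : pred H) f : K :=
  \sum_(w | Z w) (f w)@_(m - val w).

Lemma component_coeff_edge (m : 'X_{1..n}) (Z : pred H) E r g :
  (forall w, Z w -> (val w <= m)%MM) ->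
  (forall a b : H, adj E (val a) (val b) -> (val a <= m)%MM -> (val b <= m)%MM ->
     Z a = Z b) ->
  (forall a b, adj E a b -> (a \in H) && (b \in H)) ->
  edge_relation E r -> component_coeff m Z [ffun w => g * r w] = 0.
Proof.
move=> Zm ZE EH [u [v [x [y [uv e ->]]]]]; have /andP[uH vH] := EH _ _ uv.
rewrite /component_coeff.
under eq_bigr => w _ do rewrite !ffunE mulrBr mcoeffB.
have term (a : H) (t : 'I_n) :
    \sum_(w | Z w) (g * ((val w == val a)%:R * 'X_t))@_(m - val w) =
    if Z a && (U_(t) + val a <= m)%MM then g@_(m - (U_(t) + val a)) else 0.
  rewrite big_mkcond (bigD1 a) //= big1 ?addr0 => [|w wa]; last first.
    by rewrite val_eqE (negbTE wa) mul0r mulr0 mcoeff0 if_same.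
  case: ifP => //= /Zm am; rewrite eqxx mul1r mcoeffMX_le.
  have -> : (U_(t) <= m - val a)%MM = (U_(t) + val a <= m)%MM.
    apply/mnm_lepP/mnm_lepP => h i; have := h i; have := mnm_lepP am i;
      rewrite !mnmDE ?mnmBE => hi; first by rewrite leq_subRL // addnC.
    by rewrite leq_subRL // addnC.
  case: ifP => // h; congr (mcoeff _ _); apply/mnmP => i.
  by rewrite !mnmBE mnmDE subnDA subnAC.
(* Both ends contribute the coefficient of [g] at [m] minus the multidegree
   [U_(x) + u = U_(y) + v] of the relation, and they lie in [Z] together. *)
rewrite sumrB (term [` uH] x) (term [` vH] y) /= e.
have [vm|_] := boolP (U_(y) + v <= m)%MM; last by rewrite !andbF subrr.
rewrite !andbT (ZE [` uH] [` vH]) ?subrr //=.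
  by apply: lepm_trans vm; rewrite -e lem_addl.
by apply: lepm_trans vm; rewrite lem_addl.
Qed.

Lemma component_coeff_kernel (m : 'X_{1..n}) (Z : pred H) E f :
  has_linear_relations K H -> edges_generate K H E ->
  (forall w, Z w -> (val w <= m)%MM) ->
  (forall a b : H, adj E (val a) (val b) -> (val a <= m)%MM -> (val b <= m)%MM ->
     Z a = Z b) ->
  (forall a b, adj E a b -> (a \in H) && (b \in H)) ->
  phi f = 0 -> component_coeff m Z f = 0.
Proof.
move=> [q [r [lin gen _]]] Egen Zm ZE EH /gen[g hg].
rewrite /component_coeff; under eq_bigr => w _ do rewrite hg raddf_sum.
rewrite exchange_big big1 //= => j _.
have [p [c [e [he hr]]]] := (Egen (r j)).1 (lin j).
transitivity (\sum_k c k * component_coeff m Z [ffun w => g j * e k w]); last first.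
  by rewrite big1 // => k _; rewrite (component_coeff_edge (g j) Zm ZE EH (he k)) mulr0.
under [RHS]eq_bigr => k _ do rewrite mulr_sumr.
rewrite [RHS]exchange_big; apply: eq_bigr => w _ /=.
rewrite hr sum_ffunE mulr_sumr raddf_sum; apply: eq_bigr => k _ /=.
by rewrite !ffunE -scalerAr mcoeffZ.
Qed.

(** Apply the test functional, with the component of [u] for [Z], to the syzygy of
    [u] and any further divisor [w] of [lcm(u, v)]. *)
Lemma linear_relations_connected E :
  (forall u, u \in H -> squarefree_mon u) ->
  (forall a b, adj E a b -> (a \in H) && (b \in H)) ->
  edges_generate K H E -> has_linear_relations K H ->
  forall u v, u \in H -> v \in H ->
    connected_graph (between H u v) (induced_edges E (between H u v)).
Proof.
move=> sqf EH Egen lin u v uH vH; set V := between H u v.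
have uV : u \in V by rewrite btwP uH subsetUl.
pose m := [multinom maxn (u i) (v i) | i < n].
have Vm (w : 'X_{1..n}) : w \in H -> (w \in V) = (w <= m)%MM.
  move=> wH; rewrite btwP wH /=.
  apply/subsetP/mnm_lepP => h i; have := h i.
    rewrite mnmE in_setU !inE (sqf_mnmE i (sqf _ wH)) inE.
    by case: (0 < w i)%N => // /(_ isT); rewrite leq_max.
  by rewrite mnmE in_setU !inE => hi wi; move: (leq_trans wi hi); rewrite leq_max.
split; first by apply/fset0Pn; exists u.
pose e0 : rel H := fun a b => adj (induced_edges E V) (val a) (val b).
pose Z (w : H) := (val w \in V) && connect e0 [` uH] w.
have e0s : connect_sym e0 by apply: sym_connect_sym => a b; apply: adj_sym.
have Zm w : Z w -> (val w <= m)%MM by case/andP => wV _; rewrite -Vm ?(valP w).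
have ZE (a b : H) : adj E (val a) (val b) -> (val a <= m)%MM -> (val b <= m)%MM ->
    Z a = Z b.
  rewrite /Z -!Vm ?(valP a) ?(valP b) // => ab aV bV; rewrite aV bV /=.
  have ab' : connect e0 a b by apply: connect1; rewrite /e0 adj_induced ab aV.
  by apply: same_connect_r.
have reach w : w \in V -> walk (adj (induced_edges E V)) u w.
  move=> wV; have wH : w \in H by move: wV; rewrite btwP => /andP[].
  have [->|wu] := eqVneq w u; first exact: walk_refl.
  suff /andP[_ /connectP[p pp lp]] : Z [` wH].
    exists (map val p); split; last exact: etrans (last_map val p [` uH]) (congr1 val (esym lp)).
    by rewrite [path _ _ _](@path_map _ _ val _ [` uH] p).
  have um : (u <= m)%MM by rewrite -Vm.
  have wm : (w <= m)%MM by rewrite -Vm.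
  pose f : {ffun H -> {mpoly K[n]}} := [ffun t =>
    (val t == u)%:R * 'X_[m - u] - (val t == w)%:R * 'X_[m - w]].
  have phif : phi f = 0.
    rewrite /phi; under eq_bigr => t _ do rewrite ffunE mulrBl.
    rewrite sumrB (bigD1 [` uH]) //= eqxx mul1r big1 ?addr0 => [|t tu]; last first.
      by rewrite -(inj_eq val_inj) /= in tu; rewrite (negbTE tu) !mul0r.
    rewrite (bigD1 [` wH]) //= eqxx mul1r big1 ?addr0 => [|t tw]; last first.
      by rewrite -(inj_eq val_inj) /= in tw; rewrite (negbTE tw) !mul0r.
    by rewrite -!mpolyXD !submK // subrr.
  have := component_coeff_kernel lin Egen Zm ZE EH phif.
  rewrite /component_coeff; under eq_bigr => t _ do rewrite ffunE mcoeffB.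
  have Zu : Z [` uH] by rewrite /Z /= uV connect0.
  rewrite sumrB (bigD1 [` uH]) //= eqxx mul1r mcoeffX eqxx big1 ?addr0; last first.
    by move=> t /andP[_]; rewrite -(inj_eq val_inj) /= => /negbTE ->; rewrite mul0r mcoeff0.
  have [//|nZ] := boolP (Z [` wH]).
  rewrite big1 ?subr0 => [/eqP|t Zt]; first by rewrite oner_eq0.
  case: eqP => [tw|_]; last by rewrite mul0r mcoeff0.
  by case/negP: nZ; have <- : t = [` wH] by apply: val_inj.
move=> a b aV bV; apply: (@walk_trans _ _ u); last exact: reach.
by apply: walk_sym (reach _ aV); apply: adj_sym.
Qed.

End LinearRelations.

(** * The equivalence *)

Section Assembly.
Variables (K : fieldType) (n : nat).
Implicit Types (G H V : {fset 'X_{1..n}}) (E : {fset {fset 'X_{1..n}}}).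
Implicit Types (a b u v w : 'X_{1..n}).

(** The form of condition (c) that depends on the generators alone, and not on the
    edges chosen for deletion. *)
Definition btw_connected G := forall a b, a \in G -> b \in G ->
  walk (adj (induced_edges (lin_edges G) (between G a b))) a b.

Lemma adj_lin_sub H G a b : H `<=` G -> adj (lin_edges H) a b -> adj (lin_edges G) a b.
Proof.
by move=> /fsubsetP HG; rewrite !adj_lin => /and3P[/HG-> /HG-> ->].
Qed.

(** The resolution is stated for all sets [H] that linear adjacencies connect:
    [H = G] and the vertex sets of lines are the two cases of interest. *)
Lemma btw_connected_resolution d G E H s (L : {mpoly K[n]} -> Prop) :
  (forall u, u \in G -> squarefree_mon u) -> (forall u, u \in G -> mdeg u = d) ->
  reduction G E -> acyclic_graph E -> btw_connected G ->
  H `<=` G -> uniq s -> H =i s -> s != [::] ->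
  connected_order (adj (lin_edges G)) s ->
  (forall f, L f <-> mon_ideal H f) -> has_linear_resolution d L.
Proof.
move=> sqf deg red acyc btw /fsubsetP HG us Hs s0 ord hL.
have sG u : u \in s -> u \in G by rewrite -Hs; apply: HG.
have x0 : 'X_{1..n} := 0%MM.
case: s s0 us Hs ord sG => [//|a0 s'] _; set s := a0 :: s' => us Hs ord sG.
set m := size s'; have ss : size s = m.+1 by [].
have ns i : (i < m.+1)%N -> nth x0 s i \in G by move=> im; apply/sG/mem_nth.
have [t ht] : exists t : 'I_m -> nat * 'I_n * 'I_n, forall r : 'I_m,
    [/\ (r < (t r).1.1 < m.+1)%N, adj (lin_edges G) (nth x0 s r) (nth x0 s (t r).1.1)
      & (U_((t r).1.2) + nth x0 s r = U_((t r).2) + nth x0 s (t r).1.1)%MM].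
  apply: (@fin_all_exists _ _ (fun (r : 'I_m) (t : nat * 'I_n * 'I_n) =>
    [/\ (r < t.1.1 < m.+1)%N, adj (lin_edges G) (nth x0 s r) (nth x0 s t.1.1)
      & (U_(t.1.2) + nth x0 s r = U_(t.2) + nth x0 s t.1.1)%MM])) => r.
  have [p rp ap] := ord x0 r (ltn_ord r : (r.+1 < m.+1)%N).
  have := ap; rewrite adj_lin => /and3P[_ _ /lin_adjP[_ [x [y h]]]].
  by exists (p, x, y).
apply: (linear_quotients_resolution ss _ (px := fun r => (t r).1.1)
  (x := fun r => (t r).1.2) (y := fun r => (t r).2) (x0 := x0) _ _ _ _ us Hs hL) => //.
- by move=> u /sG; apply: deg.
- by move=> r; case: (ht r).
- by move=> r; case: (ht r).
- move=> r; have [/andP[rp pm]] := ht r.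
  rewrite adj_lin => /and3P[rG pG /lin_adjP[rp' _]] h.
  by have [+ _ _] := lin_supports (sqf _ rG) (sqf _ pG) rp' h; rewrite inE -leqNgt leqn0 => /eqP.
move=> r j /andP[rj jm]; have [/andP[rp pm] ap h] := ht r.
have rm : (r < m.+1)%N by apply: ltn_trans rj jm.
suff : (t r).1.2 \in mvars (nth x0 s j) by rewrite inE.
apply: (divides_of_btw_walk sqf deg red acyc ap h); last by apply: btw; apply: ns.
by apply: connected_order_walk => //; [exact: adj_sym|rewrite rp|rewrite rj].
Qed.

Lemma tree_paths_btw_connected G E : reduction G E -> is_tree G E ->
  (forall u v, u \in G -> v \in G -> forall p : seq 'X_{1..n},
     path (adj E) u p -> uniq (u :: p) -> last u p = v ->
     forall i j k : nat, (i <= j)%N -> (j <= k)%N -> (k <= size p)%N ->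
       mvars (nth u (u :: p) j) \subset
         mvars (nth u (u :: p) i) :|: mvars (nth u (u :: p) k)) ->
  btw_connected G.
Proof.
move=> red [[_ conn] _] hd a b aG bG.
have [p [pp lp up]] := walk_uniq (conn a b aG bG).
exists p; split=> //.
apply: sub_path (path_all (P := mem (between G a b)) pp _).
  move=> c c' /and3P[cc' cV c'V]; rewrite adj_induced.
  by rewrite (reduction_sub red cc'); apply/and3P.
apply/(all_nthP a) => j jp; rewrite /= btwP.
have := hd a b aG bG p pp up lp 0%N j (size p) (leq0n _) jp (leqnn _).
rewrite [nth a _ (size p)](nth_last a (a :: p)) /= lp => ->; rewrite andbT.
case: j jp => [//|j] jp; have /pathP/(_ j jp) := pp.
by move=> /(_ a) /(reduction_sub red); rewrite adj_lin => /and3P[].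
Qed.

Lemma line_connected_order H E s : reduction H E -> uniq s -> H =i s ->
  (forall u v, u \in H -> v \in H ->
     adj E u v = (index v s == (index u s).+1) || (index u s == (index v s).+1)) ->
  connected_order (adj (lin_edges H)) s.
Proof.
move=> red us Hs hE x0 r rs; exists r.+1; first by rewrite leqnn.
apply: reduction_sub red _.
rewrite hE ?Hs ?mem_nth // ?(ltnW rs) // !index_uniq // ?(ltnW rs) //.
by rewrite eqxx.
Qed.

(** The positions of adjacent vertices on an induced path differ by one, so there
    are no triangles, no edge can be deleted, and the whole linear graph, a line,
    is the only first syzygy graph. *)
Lemma induced_path_line G s E : s != [::] ->
  {subset s <= G} -> induced_path (adj (lin_edges G)) s ->
  reduction [fset u in s] E -> is_line [fset u in s] E.
Proof.
move=> s0 sG ip red; set H := [fset u in s] in red *.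
have us := induced_path_uniq ip.
have Hs : H =i s by move=> u; rewrite inE.
have adjH u v : u \in H -> v \in H -> adj (lin_edges H) u v =
    (index v s == (index u s).+1) || (index u s == (index v s).+1).
  rewrite !Hs => uH vH.
  have -> : adj (lin_edges H) u v = adj (lin_edges G) u v.
    by rewrite !adj_lin !Hs uH vH !sG.
  have := induced_path_nth u (@adj_sym _ _) (@adj_irr _ _) ip (i := index u s) (j := index v s).
  by rewrite !index_mem !nth_index // => -> //.
have eE : E = lin_edges H.
  elim: red => // E' a b c _ -> [ab bc ac _]; exfalso.
  have [aH bH cH] : [/\ a \in H, b \in H & c \in H].
    by move: ab ac; rewrite !adj_lin => /and3P[-> -> _] /and3P[_ -> _].
  move: ab bc ac; rewrite !adjH //.
  move: (index a s) (index b s) (index c s) => i j k.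
  by do 3![case/orP=> /eqP ?]; lia.
by exists s; split=> // u v uH vH; rewrite eE adjH.
Qed.

End Assembly.

(** An induced path from [a] to [b] spans a line, so the ideal of its vertices has
    a linear resolution; its linear relations connect [a] to [b] through divisors
    of [lcm(a, b)]. *)
Lemma lines_btw_connected (K : fieldType) n d (I : {mpoly K[n]} -> Prop)
    (G : {fset 'X_{1..n}}) (Gr : {fset 'X_{1..n}} -> {fset {fset 'X_{1..n}}}) :
  (forall f, I f <-> mon_ideal G f) ->
  (forall u, u \in G -> squarefree_mon u) -> (forall u, u \in G -> mdeg u = d) ->
  (forall H, H `<=` G -> is_first_syzygy_graph K H (Gr H)) ->
  connected_graph G (Gr G) ->
  (forall (L : {mpoly K[n]} -> Prop) (H : {fset 'X_{1..n}}),
     is_min_mon_gens L H -> (forall f, L f -> I f) -> H `<=` G ->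
     is_line H (Gr H) -> has_linear_resolution d L) ->
  btw_connected G.
Proof.
move=> hI sqf deg hGr [_ conn] lines a b aG bG.
have [red _ _ _] := hGr G (fsubset_refl G).
have /walk_induced[p [ip lp]] : walk (adj (lin_edges G)) a b.
  by apply: walk_sub (conn a b aG bG) => c c'; apply: reduction_sub.
set s := a :: p in ip; set H := [fset u in s].
have sG : {subset s <= G}.
  have : path (adj (lin_edges G)) a p.
    apply/(pathP a) => i lip.
    have := induced_path_nth a (@adj_sym _ _) (@adj_irr _ _) ip (ltnW lip : (i < size s)%N) (lip : (i.+1 < size s)%N).
    by rewrite eqxx.
  rewrite /s; elim: (p) (a) aG => [|c q IH] v vG /=; first by move=> _ u; rewrite inE => /eqP ->.
  rewrite adj_lin => /andP[/and3P[_ cG _] /IH qG] u.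
  by rewrite inE => /predU1P[->//|]; apply: qG.
have HG : H `<=` G by apply/fsubsetP => u; rewrite !inE; apply: sG.
have degH u : u \in H -> mdeg u = d by move/(fsubsetP HG); apply: deg.
have sqfH u : u \in H -> squarefree_mon u by move/(fsubsetP HG); apply: sqf.
have [redH _ genH _] := hGr H HG.
have lineH := induced_path_line (isT : s != [::]) sG ip redH.
have LI f : mon_ideal (K := K) H f -> I f.
  move=> [c ->]; apply/hI; exists (fun u => if u \in H then c u else 0%R).
  rewrite -(big_fset_incl _ HG) /= => [|u uG /negbTE ->]; last by rewrite GRing.mul0r.
  by rewrite big_seq [RHS]big_seq; apply: eq_bigr => u uH; rewrite uH.
have resH := lines _ _ (mon_ideal_min_gens K degH) LI HG lineH.
have relH := linear_resolution_relations (fun p => iff_refl _) degH resH.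
have aH : a \in H by rewrite !inE eqxx.
have bs : b \in a :: p by rewrite -lp mem_last.
have bH : b \in H by apply: etrans bs; apply: in_fset.
have [_ c] := linear_relations_connected sqfH (fun u v => reduction_vertices redH) genH relH aH bH.
have := c a b; rewrite !btwP aH bH subsetUl subsetUr => /(_ isT isT).
apply: walk_sub => u v; rewrite !adj_induced !btwP.
move=> /and3P[/(reduction_sub redH)/(adj_lin_sub HG) -> /andP[uH ->] /andP[vH ->]].
by rewrite !(fsubsetP HG).
Qed.

Theorem theorem2p6
    (K : fieldType) (n d : nat)
    (I : {mpoly K[n]} -> Prop) (G : {fset 'X_{1..n}})
    (hG : is_min_mon_gens I G)
    (hsqf : forall u, u \in G -> squarefree_mon u)
    (hdeg : forall u, u \in G -> mdeg u = d)
    (* [Gr H] is the chosen first syzygy graph of the ideal generated by [H] *)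
    (Gr : {fset 'X_{1..n}} -> {fset {fset 'X_{1..n}}})
    (hGr : forall H, H `<=` G -> is_first_syzygy_graph K H (Gr H))
    (htree : is_tree G (Gr G)) :
  [<-> has_linear_resolution d I;
       has_linear_relations K G;
       forall u v, u \in G -> v \in G ->
         connected_graph (between G u v)
           (induced_edges (Gr G) (between G u v));
       forall u v, u \in G -> v \in G ->
         forall p : seq 'X_{1..n},
           path (adj (Gr G)) u p -> uniq (u :: p) -> last u p = v ->
           forall i j k : nat, (i <= j)%N -> (j <= k)%N -> (k <= size p)%N ->
             mvars (nth u (u :: p) j) \subset
               mvars (nth u (u :: p) i) :|: mvars (nth u (u :: p) k);
       forall (L : {mpoly K[n]} -> Prop) (H : {fset 'X_{1..n}}),
         is_min_mon_gens L H -> (forall f, L f -> I f) -> H `<=` G ->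
         is_line H (Gr H) -> has_linear_resolution d L].
Proof.
have hI := hG.1; have [conn acyc] := htree.
have [red _ Ggen _] := hGr G (fsubset_refl G).
tfae.
- exact: linear_resolution_relations hI hdeg.
- exact: linear_relations_connected hsqf (fun u v => reduction_vertices red) Ggen.
- move=> hc u v uG vG p pp up lp i j k ij jk kp.
  set a := nth u _ i; set b := nth u _ k.
  have pG l : (l <= size p)%N -> nth u (u :: p) l \in G.
    case: l => [//|l] lp'; have /pathP/(_ l lp') := pp.
    by move=> /(_ u) /(reduction_vertices red)/andP[].
  have aG : a \in G by apply: pG; apply: leq_trans ij (leq_trans jk kp).
  have bG : b \in G by apply: pG.
  have aV : a \in between G a b by rewrite btwP aG subsetUl.
  have bV : b \in between G a b by rewrite btwP bG subsetUr.
  suff : nth u (u :: p) j \in between G a b by rewrite btwP => /andP[].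
  apply: (acyclic_path_meets (P := mem (between G a b)) acyc pp up ij jk kp) => //.
  apply: walk_sub ((hc a b aG bG).2 a b aV bV) => c c'.
  by rewrite adj_induced.
- move=> hd L H hL _ HG [s [s0 us Hs hE]].
  have [redH _ _ _] := hGr H HG.
  have ord : connected_order (adj (lin_edges G)) s.
    move=> x0 r /(line_connected_order redH us Hs hE x0)[p rp /(adj_lin_sub HG) ap].
    by exists p.
  apply: (btw_connected_resolution hsqf hdeg red acyc _ HG us Hs s0 ord hL.1).
  exact: tree_paths_btw_connected red htree hd.
- move=> lines.
  have [s [us Gs ord]] := connected_order_exists conn (fun u v => reduction_vertices red).
  have s0 : s != [::].
    by have [/fset0Pn[u]] := conn; rewrite Gs; case: (s).
  have {}ord : connected_order (adj (lin_edges G)) s.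
    by move=> x0 r /(ord x0)[p rp /(reduction_sub red) ap]; exists p.
  apply: (btw_connected_resolution hsqf hdeg red acyc _ (fsubset_refl G) us Gs s0 ord hI).
  exact: lines_btw_connected hI hsqf hdeg hGr conn lines.
Qed.
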